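(* Let $m,n\in\mathbb N$ be standard and let $\mathcal A=(\alpha_{ij})$ be an $m\times n$ reduced matrix over $\mathbb E$, with $\alpha_{ij}=a_{ij}+A_{ij}$ for all $1\le i\le m$, $1\le j\le n$. Assume that $\operatorname{mr}(\mathcal A)=1$ and that $\alpha_{11}$ is zeroless. Put $\overline A_1=\max_{1\le i\le m}A_{i1}$ and $\underline A_1^C=\min_{1\le i\le m,\ 2\le j\le n}A_{ij}$. Suppose that (i) $\dfrac{\overline A_1}{\alpha_{11}}\subseteq\underline A_1^C$, or (ii) all $A_{ij}$, $1\le i\le m$, $1\le j\le n$, are equal to some neutrix $A$. Then $r(\mathcal A)=\operatorname{sr}(\mathcal A)=1$ (in particular the strict rank is defined).
   Context: We work in nonstandard analysis with external sets (the theory HST of Kanovei and Reeken, extending a bounded form of Nelson's IST), so $\mathbb R$ contains nonstandard numbers. A neutrix is a convex additive subgroup of $\mathbb R$ (possibly an external set), e.g. $\oslash$, the set of all infinitesimals. Neutrices are ordered by inclusion (max, min of neutrices refer to inclusion). An external number is a set $\alpha=a+A=\{a+x: x\in A\}$ with $a\in\mathbb R$ and $A$ a neutrix (its neutrix part); $\mathbb E$ is the class of external numbers. $\alpha$ is zeroless if $0\notin\alpha$; otherwise $\alpha$ is a neutrix. Operations are Minkowski operations: $(a+A)\pm(b+B)=(a\pm b)+(A+B)$, $(a+A)(b+B)=ab+aB+bA+AB$; for a neutrix $N$ and zeroless $\beta=b+B$, $N/\beta=N/b$. Order: $\alpha\le\beta$ iff $\forall a\in\alpha\,\exists b\in\beta\,(a\le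 b)$; $|\alpha|=\alpha$ if $0\le\alpha$ and $|\alpha|=-\alpha$ otherwise. A matrix $(\alpha_{ij})$ over $\mathbb E$ is reduced if $\max_{i,j}|\alpha_{ij}|=1+A'$ for some neutrix $A'\subseteq\oslash$. The determinant of a $k\times k$ matrix over $\mathbb E$ is $\sum_{\sigma\in S_k}\operatorname{sgn}(\sigma)\alpha_{1\sigma(1)}\cdots\alpha_{k\sigma(k)}$; a minor of order $k$ is the determinant of a $k\times k$ submatrix. A neutrix vector is a vector all of whose coordinates are neutrices. A set $\{\xi_1,\dots,\xi_p\}$ of vectors of $\mathbb E^n$ is linearly dependent if there exist real numbers $t_1,\dots,t_p$, not all zero, and a neutrix vector $A$ with $t_1\xi_1+\cdots+t_p\xi_p=A$; otherwise it is linearly independent. The row-rank $r(\mathcal A)$ is the maximal cardinality of a linearly independent subset of the set of row vectors of $\mathcal A$. The minor-rank $\operatorname{mr}(\mathcal A)$ is the largest natural number $k$ such that $\mathcal A$ has a zeroless minor of order $k$. A representative matrix of $\mathcal A$ is a real matrix $(b_{ij})$ with $b_{ij}\in\alpha_{ij}$ for all $i,j$. If there exists a representative matrix whose (usual) rank equals $\operatorname{mr}(\mathcal A)$, then the minor-rank is called a strict rank and denoted $\operatorname{sr}(\mathcal A)$; otherwise the strict rank is not defined. *)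

(* Defs.v *)
From HB Require Import structures.
From mathcomp Require Import all_boot all_order all_algebra all_fingroup.
From mathcomp Require Import boolp classical_sets reals num_normedtype.

Set Implicit Arguments.
Unset Strict Implicit.
Unset Printing Implicit Defensive.

Import Order.TTheory GRing.Theory Num.Theory.

Local Open Scope classical_set_scope.
Local Open Scope ring_scope.

(* In HST, the set of (standard and nonstandard) real numbers is the image *R
   of the ordinary real line R under an elementary embedding, and the external
   subsets of *R are simply its subsets in the ambient universe.  Accordingly R
   is a realType, *R is an ordered field K, an external set is any [set K], and
   a standard natural number is any element of [nat].

   [star] sends each k-ary relation on R to its k-ary extension to K.  Being
   compatible with the Boolean operations, with substitution of variables and
   with its adjoint [fun X => [set z \o f | z in X]] (existential
   quantification when f is injective, equality when f is not), it preserves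
   and reflects every first-order formula over all relations on R: this is the
   transfer principle. *)
Record nonstandard_extension (R : realType) (K : realFieldType)
    (star : forall k, set ('I_k -> R) -> set ('I_k -> K)) : Prop := {
  starC : forall k (X : set ('I_k -> R)), star k (~` X) = ~` (star k X);
  starI : forall k (X Y : set ('I_k -> R)),
    star k (X `&` Y) = star k X `&` star k Y;
  star_subst : forall k l (f : 'I_k -> 'I_l) (X : set ('I_k -> R)),
    star l [set z : 'I_l -> R | X (z \o f)] =
    [set z : 'I_l -> K | star k X (z \o f)];
  star_exists : forall k l (f : 'I_k -> 'I_l) (X : set ('I_l -> R)),
    star k [set z \o f | z in X] = [set z \o f | z in star l X];
  star_add : star 3%N [set x : 'I_3 -> R | x ord0 + x 1 = x ord_max] =
             [set x : 'I_3 -> K | x ord0 + x 1 = x ord_max];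
  star_mul : star 3%N [set x : 'I_3 -> R | x ord0 * x 1 = x ord_max] =
             [set x : 'I_3 -> K | x ord0 * x 1 = x ord_max];
  star_le : star 2%N [set x : 'I_2 -> R | x ord0 <= x ord_max] =
            [set x : 'I_2 -> K | x ord0 <= x ord_max];
  star_proper : exists2 e : K,
    e != 0 & forall n : nat, `|e| < n.+1%:R^-1 }.

Section ExternalNumbers.
Variable K : realFieldType.
Implicit Types X Y N : set K.

Definition infinitesimals : set K :=
  [set x | forall n : nat, `|x| < n.+1%:R^-1].

Definition neutrix N : Prop :=
  [/\ N 0, (forall x y, N x -> N y -> N (x - y)) & is_interval N].

Definition mink_add X Y : set K := [set x + y | x in X & y in Y].
Definition mink_mul X Y : set K := [set x * y | x in X & y in Y].
Definition mink_scale (t : K) X : set K := [set t * x | x in X].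

Definition extnum (a : K) N : set K := [set a + x | x in N].

Definition zeroless X : Prop := ~ X 0.

Definition ext_le X Y : Prop := forall x, X x -> exists2 y, Y y & x <= y.

Definition ext_abs X : set K :=
  if `[< ext_le [set 0] X >] then X else [set - x | x in X].

Definition ext_max X Y : set K := if `[< ext_le X Y >] then Y else X.

(* On neutrices, the least one [set 0] is neutral for incl_max and the greatest
   one setT is neutral for incl_min. *)
Definition incl_max X Y : set K := if `[< X `<=` Y >] then Y else X.
Definition incl_min X Y : set K := if `[< X `<=` Y >] then X else Y.

Section Matrices.
Variables m n : nat.
Implicit Type A : 'M[set K]_(m, n).

(* [set 0] is the least absolute value of an external number, hence neutral
   for ext_max. *)
Definition reduced A : Prop :=
  exists N, [/\ neutrix N, N `<=` infinitesimals &
    \big[ext_max/[set 0]]_(i < m) \big[ext_max/[set 0]]_(j < n)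
      ext_abs (A i j) = extnum 1 N].

Definition representative A (B : 'M[K]_(m, n)) : Prop :=
  forall i j, A i j (B i j).

End Matrices.

Definition ext_det k (A : 'M[set K]_k) : set K :=
  \big[mink_add/[set 0]]_(s : 'S_k)
    mink_scale ((-1) ^+ s) (\big[mink_mul/[set 1]]_(i < k) A i (s i)).

Definition has_zeroless_minor m n (A : 'M[set K]_(m, n)) (k : nat) : Prop :=
  exists (f : 'I_k -> 'I_m) (g : 'I_k -> 'I_n),
    [/\ {homo f : i j / (i < j)%N}, {homo g : i j / (i < j)%N} &
        zeroless (ext_det (mxsub f g A))].

Definition minor_rank m n (A : 'M[set K]_(m, n)) : nat :=
  \max_(k < (minn m n).+1 | `[< has_zeroless_minor A k >]) k.

Definition lin_dependent n p (xi : 'I_p -> 'rV[set K]_n) : Prop :=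
  exists2 t : 'I_p -> K, (exists i, t i != 0) &
  exists2 B : 'rV[set K]_n, (forall j, neutrix (B 0 j)) &
  \row_j \big[mink_add/[set 0]]_(i < p) mink_scale (t i) (xi i 0 j) = B.

(* A subset with p elements of the set of rows is an injective enumeration by
   'I_p of rows; equal rows count once. *)
Definition has_independent_rows m n (A : 'M[set K]_(m, n)) (p : nat) : Prop :=
  exists xi : 'I_p -> 'rV[set K]_n,
    [/\ injective xi, (forall k, exists i, xi k = row i A) &
        ~ lin_dependent xi].

Definition row_rank m n (A : 'M[set K]_(m, n)) : nat :=
  \max_(p < m.+1 | `[< has_independent_rows A p >]) p.

Definition strict_rank m n (A : 'M[set K]_(m, n)) : option nat :=
  if `[< exists2 B, representative A B & \rank B = minor_rank A >]
  then Some (minor_rank A) else None.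

End ExternalNumbers.

(* Main.v *)
Require Import Defs.
From HB Require Import structures.
From mathcomp Require Import all_boot all_order all_algebra all_fingroup.
From mathcomp Require Import boolp classical_sets reals num_normedtype.
From mathcomp Require Import ring lra.

Set Implicit Arguments.
Unset Strict Implicit.
Unset Printing Implicit Defensive.

Import Order.TTheory GRing.Theory Num.Theory.

Local Open Scope classical_set_scope.
Local Open Scope ring_scope.

(** Everything reduces to finding a representative matrix [B] of rank one.  A
    linear relation between rows of a representative matrix is also a relation
    between the external rows, up to a neutrix vector, so the row-rank never
    exceeds the rank of a representative ([row_rank_le_rank]); it is positive
    because some entry is zeroless.

    Minor-rank one makes every minor of order 2 contain 0, so that each 2x2
    submatrix has a singular representative ([singular_minors]).  Those
    representatives depend on the submatrix, and have to be reconciled.  Take a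
    zeroless pivot [alpha p q] with the following property: every neutrix [A i q]
    of its column, divided by [a p q], is contained in every [A k j] with
    [j != q].  Under (i) the entry (0, 0) is such a pivot.  Under (ii) one takes
    an entry whose absolute value is the maximum 1 + N: dividing by
    it does not change the common neutrix.

    Since the matrix is reduced, all its elements are bounded by 2, and
    neutrices absorb multiplication by such numbers.  Column [q] being that
    precise, the minors through the pivot give that [alpha i j] contains
    [a i q / a p q * z] for some [z] in [alpha p j] ([pivot_entry]).  If
    [alpha i q] contains 0, then so does all of row [i]
    ([entry_not_zeroless]), and this row is represented by 0.  The remaining rows
    are represented by [a i q *: c], where [c j] has to lie in all the cosets
    [alpha i j / a i q].  It is not enough to compare each of these with the
    pivot row, whose neutrices may be the largest ones; but the minors on rows
    [i] and [k] and columns [q] and [j] show that any two of these cosets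
    meet ([rows_compatible]).  Cosets of neutrices which meet are nested, so the
    coset with the least neutrix is contained in the others
    ([column_coefficient]). *)

(** * Neutrices and their cosets *)

Section Neutrices.
Variable K : realFieldType.
Implicit Types (N M : set K) (a b t x y : K).

Lemma neutrix0 N : neutrix N -> N 0.
Proof. by case. Qed.

Lemma neutrixB N x y : neutrix N -> N x -> N y -> N (x - y).
Proof. by case=> _ NB _; exact: NB. Qed.

Lemma neutrixN N x : neutrix N -> N x -> N (- x).
Proof. by move=> nN Nx; rewrite -sub0r; apply: neutrixB (neutrix0 nN) Nx. Qed.

Lemma neutrixD N x y : neutrix N -> N x -> N y -> N (x + y).
Proof.
by move=> nN Nx Ny; rewrite -[y]opprK; apply: neutrixB (neutrixN nN Ny).
Qed.

Lemma neutrix_le N x y : neutrix N -> N x -> `|y| <= `|x| -> N y.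
Proof.
move=> nN Nx; rewrite ler_norml => /andP[xy yx].
have Nx' : N `|x| by case: (ger0P x) => _ //; exact: neutrixN.
by case: (nN) => _ _; apply; [exact: neutrixN Nx'|exact: Nx'|rewrite xy].
Qed.

(** Any standard bound on [t] would do, as a neutrix is convex and closed under
    addition; 2 bounds all the factors that occur below. *)
Lemma neutrixM N t x : neutrix N -> `|t| <= 2 -> N x -> N (t * x).
Proof.
move=> nN t2 Nx; apply: (neutrix_le nN (neutrixD nN Nx Nx)).
by rewrite normrM -mulr2n -mulr_natl normrM normr_nat ler_wpM2r.
Qed.

(** An element of [N] outside [M] exceeds every element of [M] in absolute value,
    and a neutrix contains whatever is smaller than one of its elements. *)
Lemma neutrix_total N M : neutrix N -> neutrix M -> N `<=` M \/ M `<=` N.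
Proof.
move=> nN nM; have [|NM] := pselect (N `<=` M); [by left | right].
move=> y My; apply: contrapT => Ny; apply: NM => x Nx.
apply: (neutrix_le nM My); rewrite leNgt; apply/negP => /ltW yx.
exact: Ny (neutrix_le nN Nx yx).
Qed.

Lemma neutrix_set0 : neutrix [set (0 : K)].
Proof.
split=> //= [x y -> ->|x y /= -> -> z]; first by rewrite subrr.
by rewrite -eq_le => /eqP.
Qed.

Lemma neutrix_setT : neutrix [set: K].
Proof. by split. Qed.

Lemma neutrix_mink_scale t N : neutrix N -> neutrix (mink_scale t N).
Proof.
move=> nN; split.
- by exists 0; [exact: neutrix0|rewrite mulr0].
- by move=> _ _ [x Nx <-] [y Ny <-]; exists (x - y);
    [exact: neutrixB|rewrite mulrBr].
move=> _ _ [x Nx <-] [y Ny <-] z /andP[xz zy].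
have [t0|t0] := eqVneq t 0.
  rewrite t0 !mul0r in xz zy; exists 0; first exact: neutrix0.
  by rewrite mulr0; apply/le_anti; rewrite xz zy.
exists (z / t); last by rewrite mulrC divfK.
have [_ _ iN] := nN.
have [tp|tn] : 0 < t \/ t < 0 by case: (ltgtP t 0) t0; auto.
- by apply: (iN x y); rewrite ?ler_pdivlMr ?ler_pdivrMr // !(mulrC _ t) xz.
- by apply: (iN y x); rewrite ?ler_ndivlMr ?ler_ndivrMr // !(mulrC _ t) xz zy.
Qed.

Lemma neutrix_mink_add N M : neutrix N -> neutrix M -> neutrix (mink_add N M).
Proof.
move=> nN nM; have [NM|MN] := neutrix_total nN nM.
- suff -> : mink_add N M = M by [].
  apply/seteqP; split=> [_ [x Nx [y My <-]]|y My].
    exact: (neutrixD nM (NM _ Nx) My).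
  by exists 0; [exact: neutrix0|exists y => //; rewrite add0r].
- suff -> : mink_add N M = N by [].
  apply/seteqP; split=> [_ [x Nx [y My <-]]|x Nx].
    exact: (neutrixD nN Nx (MN _ My)).
  by exists x => //; exists 0; [exact: neutrix0|rewrite addr0].
Qed.

Lemma extnumE a N x : extnum a N x <-> N (x - a).
Proof.
split=> [[y Ny <-]|Nx]; first by rewrite addrC addKr.
by exists (x - a) => //; rewrite addrC subrK.
Qed.

Lemma extnum_zeroless a N : neutrix N -> zeroless (extnum a N) <-> ~ N a.
Proof.
move=> nN; rewrite /zeroless extnumE sub0r; split=> Na /(neutrixN nN) //.
by rewrite opprK.
Qed.

Lemma extnum_center a b N : neutrix N -> extnum a N b -> extnum a N = extnum b N.
Proof.
move=> nN /extnumE Nba; apply/seteqP; split=> x /extnumE Nx; apply/extnumE.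
- by have := neutrixB nN Nx Nba; rewrite opprB addrA subrK.
- by have := neutrixD nN Nx Nba; rewrite addrA subrK.
Qed.

Lemma mink_add_extnum a b N M :
  mink_add (extnum a N) (extnum b M) = extnum (a + b) (mink_add N M).
Proof.
apply/seteqP; split=> [_ [_ [x Nx <-] [_ [y My <-] <-]]|_ [_ [x Nx [y My <-]] <-]].
- by exists (x + y); [exists x => //; exists y|rewrite addrACA].
- by exists (a + x); [exists x|exists (b + y); [exists y|rewrite addrACA]].
Qed.

Lemma mink_scale_extnum t a N :
  mink_scale t (extnum a N) = extnum (t * a) (mink_scale t N).
Proof.
apply/seteqP; split=> [_ [_ [x Nx <-] <-]|_ [_ [x Nx <-] <-]].
- by exists (t * x); [exists x|rewrite mulrDr].
- by exists (a + x); [exists x|rewrite mulrDr].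
Qed.

Lemma extnum0 N : extnum 0 N = N.
Proof. by apply/seteqP; split=> x; rewrite extnumE subr0. Qed.

(** Used with representatives [b i] on which the combination vanishes: what
    remains is then a neutrix. *)
Lemma mink_comb_extnum p (t : 'I_p -> K) (b : 'I_p -> K) (N : 'I_p -> set K) :
  (forall i, neutrix (N i)) ->
  exists2 M, neutrix M & \big[@mink_add K/[set 0]]_(i < p)
    mink_scale (t i) (extnum (b i) (N i)) = extnum (\sum_i t i * b i) M.
Proof.
move=> nN; elim/big_rec2: _ => [|i b' X _ [M nM ->]].
  by exists [set 0]; [exact: neutrix_set0|rewrite extnum0].
exists (mink_add (mink_scale (t i) (N i)) M).
  exact: neutrix_mink_add (neutrix_mink_scale _ (nN i)) nM.
by rewrite mink_scale_extnum mink_add_extnum.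
Qed.

End Neutrices.

(** * Row-rank and representative matrices *)

Section RowRank.
Variables (K : realFieldType) (m n : nat).
Variables (alpha : 'M[set K]_(m, n)) (a : 'M[K]_(m, n)) (A : 'M[set K]_(m, n)).
Hypothesis nA : forall i j, neutrix (A i j).
Hypothesis alphaE : forall i j, alpha i j = extnum (a i j) (A i j).

(** The coefficients are those of a linear relation between the rows [f k] of
    the representative: recentring the entries at this representative makes
    the real part of the combination zero. *)
Lemma rows_dependent_gt_rank (B : 'M[K]_(m, n)) p (f : 'I_p -> 'I_m)
    (xi : 'I_p -> 'rV[set K]_n) :
  representative alpha B -> (forall k, xi k = row (f k) alpha) ->
  (\rank B < p)%N -> lin_dependent xi.
Proof.
move=> rB xiE rk_lt.
have : kermx (rowsub f B) != 0.
  rewrite kermx_eq0 /row_free neq_ltn.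
  by rewrite (leq_ltn_trans _ rk_lt) // mxrankS // rowsub_sub.
case/rowV0Pn => t /sub_kermxP tB0 t_neq0.
have [k tk0] : exists k, t 0 k != 0 by apply/rV0Pn.
have comb j : exists2 M : set K, neutrix M &
    \big[@mink_add K/[set 0]]_(i < p) mink_scale (t 0 i) (xi i 0 j) = M.
  have [M nM eM] := mink_comb_extnum (t 0) (fun i => B (f i) j)
    (fun i => nA (f i) j).
  have tBj0 : \sum_i t 0 i * B (f i) j = 0.
    have := congr1 (fun C : 'rV_n => C 0 j) tB0.
    by rewrite !mxE => e; rewrite -[RHS]e; apply: eq_bigr => i _; rewrite !mxE.
  rewrite tBj0 extnum0 in eM.
  exists M => //; rewrite -eM; apply: eq_bigr => i _.
  rewrite xiE mxE alphaE (@extnum_center _ _ (B (f i) j)) //.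
  by rewrite -alphaE.
exists (t 0); first by exists k.
eexists; last by [].
by move=> j; rewrite mxE; have [M nM ->] := comb j.
Qed.

Lemma row_rank_le_rank (B : 'M[K]_(m, n)) :
  representative alpha B -> (row_rank alpha <= \rank B)%N.
Proof.
move=> rB; apply/bigmax_leqP => p /asboolP[xi [_ xiE indep]].
rewrite leqNgt; apply/negP => rk_lt.
have /choice[f fE] := xiE.
exact: indep (rows_dependent_gt_rank rB fE rk_lt).
Qed.

Lemma row_rank_gt0 i j : zeroless (alpha i j) -> (0 < row_rank alpha)%N.
Proof.
move=> zl; have m_gt0 : (1 < m.+1)%N.
  by rewrite ltnS; exact: leq_ltn_trans (leq0n i) (ltn_ord i).
apply: (@leq_bigmax_cond _ _ (fun p : 'I_m.+1 => nat_of_ord p) (Ordinal m_gt0)).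
apply/asboolP; change (has_independent_rows alpha 1).
exists (fun=> row i alpha).
split=> [k l _|k|[t [k tk0]]].
- by rewrite !ord1.
- by exists i.
case=> B nB /(congr1 (fun C : 'rV_n => C 0 j)).
rewrite !mxE big_ord_recl big_ord0 => eB; have := neutrix0 (nB j); rewrite -eB.
move=> [_ [x ax <-] [_ -> /eqP]]; rewrite addr0 mulf_eq0.
have -> : ord0 = k by rewrite [k]ord1; apply/val_inj.
by rewrite (negbTE tk0) /= => /eqP x0; apply: zl; rewrite -x0.
Qed.

End RowRank.

(** * Minors of order two *)

Section Minors.
Variable K : realFieldType.

(** Both Minkowski sums and Minkowski products have this form, [op] being the
    underlying operation of the field. *)
Lemma big_minkP (op : K -> K -> K) idx (I : finType) (F : I -> set K) x :
  (\big[(fun X Y => [set op x y | x in X & y in Y])/[set idx]]_i F i) x ->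
  exists2 y : I -> K, (forall i, F i (y i)) & x = \big[op/idx]_i y i.
Proof.
set opS := fun X Y : set K => _.
suff H r : uniq r -> (\big[opS/[set idx]]_(i <- r) F i) x ->
    exists2 y : I -> K, (forall i, i \in r -> F i (y i)) &
    x = \big[op/idx]_(i <- r) y i.
  move=> /(H _ (index_enum_uniq I))[y yF ->]; exists y => // i.
  exact/yF/mem_index_enum.
elim: r x => [|i r IH] x /=.
  by rewrite big_nil => _ ->; exists (fun=> 0); rewrite ?big_nil.
case/andP=> ir ur; rewrite big_cons => -[u Fu [_ /(IH _ ur)[y yF ->] <-]].
exists (fun j => if j == i then u else y j) => [j|].
  by rewrite inE; case: eqVneq => [->|_ /=]; last exact: yF.
rewrite big_cons eqxx; congr (op _ _); apply: eq_big_seq => j jr.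
by case: eqVneq => // ji; rewrite ji (negbTE ir) in jr.
Qed.

Lemma perm_ord2 (s : 'S_2) i : s = tperm i (s i).
Proof.
have other (k l : 'I_2) : k != i -> l != i -> k = l.
  by case: i k l => [[|[|i]] i2] [[|[|k]] k2] [[|[|l]] l2] //= _ _; apply/val_inj.
apply/permP => k; have [->|ki] := eqVneq k i; first by rewrite tpermL.
have [si|si] := eqVneq (s i) i.
  by rewrite si tperm1 perm1; apply: other => //;
    apply: contraNneq ki => sk; apply/eqP/(@perm_inj _ s); rewrite sk si.
rewrite (other _ _ ki si) tpermR.
have [//|sk] := eqVneq (s (s i)) i.
by have /perm_inj/eqP := other _ _ sk si; rewrite (negbTE si).
Qed.

(** In general an element of an external determinant chooses the factor from
    entry (i, s i) independently for each permutation [s].  In order 2 each entry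
    occurs in only one term of the expansion, so that these choices do form a
    matrix. *)
Lemma ext_det2P (A : 'M[set K]_2) x :
  ext_det A x -> exists2 M : 'M[K]_2, representative A M & x = \det M.
Proof.
move=> /(big_minkP (op := +%R))[y yF ->].
have /choice[Y YP] (s : 'S_2) : exists Y : 'I_2 -> K,
    (forall i, A i (s i) (Y i)) /\ y s = (-1) ^+ s * \prod_i Y i.
  by have [z /(big_minkP (op := *%R))[Y YA ->] <-] := yF s; exists Y.
exists (\matrix_(i, j) Y (tperm i j) i) => [i j|].
  by rewrite mxE; have [/(_ i) + _] := YP (tperm i j); rewrite tpermL.
apply: eq_bigr => s _; have [_ ->] := YP s; congr (_ * _).
by apply: eq_bigr => i _; rewrite mxE -perm_ord2.
Qed.

Lemma ext_det2_singular (A : 'M[set K]_2) : ~ zeroless (ext_det A) ->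
  exists2 M : 'M[K]_2, representative A M & M 0 0 * M 1 1 = M 0 1 * M 1 0.
Proof.
move=> /contrapT/ext_det2P[M rM /esym/eqP/det0P[v v0 vM]]; exists M => //.
have E j : v 0 0 * M 0 j + v 0 1 * M 1 j = 0.
  have := congr1 (fun C : 'rV_2 => C 0 j) vM.
  by rewrite !mxE big_ord_recl big_ord1 => <-; congr (_ + v 0 _ * M _ j);
     apply/val_inj.
have [v00|v00] := eqVneq (v 0 0) 0.
  have v01 : v 0 1 != 0.
    apply: contraNneq v0 => v01; apply/eqP/rowP => j; rewrite mxE.
    by case: j => [[|[|j]] j2] //; [rewrite -[RHS]v00|rewrite -[RHS]v01];
      congr (v 0 _); apply/val_inj.
  have M1 j : M 1 j = 0.
    by have := E j; rewrite v00 mul0r add0r => /eqP;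
      rewrite mulf_eq0 (negbTE v01) => /eqP.
  by rewrite !M1 !mulr0.
apply: (mulfI v00); have := E 0; have := E 1 => E1 E0.
have -> : v 0 0 * (M 0 0 * M 1 1) = v 0 0 * M 0 0 * M 1 1 by ring.
have -> : v 0 0 * (M 0 1 * M 1 0) = v 0 0 * M 0 1 * M 1 0 by ring.
have ->: v 0 0 * M 0 0 = - (v 0 1 * M 1 0) by apply/eqP; rewrite -addr_eq0 E0.
have ->: v 0 0 * M 0 1 = - (v 0 1 * M 1 1) by apply/eqP; rewrite -addr_eq0 E1.
ring.
Qed.

(** Increasing rows and columns give a minor in the sense of the minor-rank.
    The relation is symmetric under exchanging two rows or two columns, which
    yields the other orders, and it is trivial for equal rows or columns. *)
Lemma singular_minors m n (alpha : 'M[set K]_(m, n)) i k j l :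
  minor_rank alpha = 1%N -> (forall i j, alpha i j !=set0) ->
  exists x y z w, [/\ alpha i j x, alpha k l y, alpha i l z, alpha k j w &
    x * y = z * w].
Proof.
move=> mr1 ne.
have [x0 ij] := ne i j; have [y0 kl] := ne k l.
have [z0 il] := ne i l; have [w0 kj] := ne k j.
have sorted (i' k' : 'I_m) (j' l' : 'I_n) : (i' < k')%N -> (j' < l')%N ->
    exists x y z w, [/\ alpha i' j' x, alpha k' l' y, alpha i' l' z,
      alpha k' j' w & x * y = z * w].
  move=> ik jl.
  pose f (b : 'I_2) := if b == 0 then i' else k'.
  pose g (b : 'I_2) := if b == 0 then j' else l'.
  have : ~ zeroless (ext_det (mxsub f g alpha)).
    move=> zl; have min2 : (2 < (minn m n).+1)%N.
      rewrite ltnS leq_min (leq_ltn_trans (leq_ltn_trans (leq0n _) ik)) //.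
      by rewrite (leq_ltn_trans (leq_ltn_trans (leq0n _) jl)).
    have : (2 <= minor_rank alpha)%N.
      apply: (@leq_bigmax_cond _ _ (fun p : 'I__ => nat_of_ord p) (Ordinal min2)).
      apply/asboolP; exists f, g; split=> //.
      - by case=> [[|[|b]] b2] [[|[|c]] c2].
      - by case=> [[|[|b]] b2] [[|[|c]] c2].
    by rewrite mr1.
  move=> /ext_det2_singular[M rM detM].
  exists (M 0 0), (M 1 1), (M 0 1), (M 1 0).
  by split=> //; [have := rM 0 0|have := rM 1 1|have := rM 0 1|have := rM 1 0];
    rewrite mxE.
case: (ltngtP i k) => [ik|ki|/val_inj ik].
- case: (ltngtP j l) => [jl|lj|/val_inj jl]; first exact: sorted.
    by have [x [y [z [w [? ? ? ? e]]]]] := sorted _ _ _ _ ik lj; exists z, w, x, y.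
  by subst l; exists x0, w0, x0, w0.
- case: (ltngtP j l) => [jl|lj|/val_inj jl].
  + have [x [y [z [w [? ? ? ? e]]]]] := sorted _ _ _ _ ki jl.
    by exists w, z, y, x; split=> //; rewrite mulrC -e mulrC.
  + have [x [y [z [w [? ? ? ? e]]]]] := sorted _ _ _ _ ki lj.
    by exists y, x, w, z; split=> //; rewrite mulrC e mulrC.
  by subst l; exists x0, w0, x0, w0.
by subst k; exists x0, z0, z0, x0; rewrite mulrC.
Qed.

End Minors.

(** * A rank-one representative from a precise pivot column *)

Section Pivot.
Variables (K : realFieldType) (m n : nat).
Variables (alpha : 'M[set K]_(m, n)) (a : 'M[K]_(m, n)) (A : 'M[set K]_(m, n)).
Hypothesis nA : forall i j, neutrix (A i j).
Hypothesis alphaE : forall i j, alpha i j = extnum (a i j) (A i j).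
Hypothesis alpha_le2 : forall i j x, alpha i j x -> `|x| <= 2.
Hypothesis minors : forall i k j l, exists x y z w,
  [/\ alpha i j x, alpha k l y, alpha i l z, alpha k j w & x * y = z * w].
Variables (p : 'I_m) (q : 'I_n).
Hypothesis zl_pq : zeroless (alpha p q).
Hypothesis rel_imprecision : forall i k j x,
  j != q -> A i q x -> A k j (x / a p q).

Let alphaP i j x : alpha i j x <-> A i j (x - a i j).
Proof. by rewrite alphaE extnumE. Qed.

Lemma zeroless_center i j : zeroless (alpha i j) -> a i j != 0.
Proof.
rewrite alphaE => /(extnum_zeroless _ (nA i j)) Na; apply/eqP => a0.
by apply: Na; rewrite a0; exact: neutrix0.
Qed.

Lemma zeroless_ratio i j x : zeroless (alpha i j) -> A i j x ->
  `|x / a i j| <= 2.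
Proof.
move=> zl Ax; have a0 := zeroless_center zl.
move: zl; rewrite alphaE => /(extnum_zeroless _ (nA i j)) Na.
rewrite normrM normfV ler_pdivrMr ?normr_gt0 //.
have xa : `|x| <= `|a i j|.
  rewrite leNgt; apply/negP => /ltW ax.
  exact: Na (neutrix_le (nA i j) Ax ax).
by apply: (le_trans xa); rewrite ler_peMl // ler1n.
Qed.

(** Write the minor as (a p q + x') y = (a i q + w') z and divide by [a p q]:
    the errors x' / a p q and w' / a p q lie in [A i j] by the choice of the pivot,
    and [y] and [z] are bounded.  Thus the imprecision of the pivot column is
    absorbed, and only that of [z] in [alpha p j] remains. *)
Lemma pivot_entry i j : j != q ->
  exists2 z, alpha p j z & alpha i j (a i q / a p q * z).
Proof.
move=> jq; have P0 := zeroless_center zl_pq.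
have [x [y [z [w [xE yE zE wE xyzw]]]]] := minors p i q j.
exists z => //; apply/alphaP.
have nij := nA i j.
have wz := neutrixM nij (alpha_le2 zE)
  (rel_imprecision i jq ((alphaP _ _ _).1 wE)).
have xy := neutrixM nij (alpha_le2 yE)
  (rel_imprecision i jq ((alphaP _ _ _).1 xE)).
have -> : a i q / a p q * z - a i j =
    (y - a i j) + y * ((x - a p q) / a p q) - z * ((w - a i q) / a p q).
  have -> : y - a i j + y * ((x - a p q) / a p q) = x * y / a p q - a i j.
    by field.
  by rewrite xyzw; field.
exact: neutrixB (neutrixD _ ((alphaP _ _ _).1 yE) xy) wz.
Qed.

(** Here [a i q] is itself in [A i q], hence [a i q / a p q] is in [A i j]
    and the element provided by [pivot_entry] is negligible. *)
Lemma entry_not_zeroless i j : j != q -> ~ zeroless (alpha i q) -> alpha i j 0.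
Proof.
move=> jq /contrapT; rewrite alphaP sub0r => /(neutrixN (nA i q)).
rewrite opprK => Aiq.
have [z zE /alphaP azE] := pivot_entry i jq.
have := neutrixM (nA i j) (alpha_le2 zE) (rel_imprecision i jq Aiq).
move=> /(neutrixB (nA i j) azE); rewrite alphaP.
by rewrite mulrC addrAC subrr.
Qed.

(** A shared [s] is read off the minor on rows [i], [k] and columns [q], [j],
    after writing the elements of column [j] in the form given by [pivot_entry].
    The errors of column [q] are harmless for two reasons: against a bounded
    factor they are small relative to the pivot, and against an error of
    column [j] it is enough that they are smaller than the zeroless centres
    [a i q] and [a k q]. *)
Lemma rows_compatible i k j : j != q ->
  zeroless (alpha i q) -> zeroless (alpha k q) ->
  exists2 s, alpha i j (a i q * s) & alpha k j (a k q * s).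
Proof.
move=> jq zli zlk.
have P0 := zeroless_center zl_pq.
have i0 := zeroless_center zli; have k0 := zeroless_center zlk.
have [zi ziE iE] := pivot_entry i jq; have [zk zkE kE] := pivot_entry k jq.
have [X [Y [Z [W [XE YE ZE WE e]]]]] := minors i k q j.
move/alphaP in XE; move/alphaP in YE; move/alphaP in ZE; move/alphaP in WE.
move/alphaP in iE; move/alphaP in kE.
have nij := nA i j; have nkj := nA k j.
pose x := X - a i q; pose w := W - a k q.
pose y := Y - a k q / a p q * zk; pose z := Z - a i q / a p q * zi.
have yE : A k j y.
  by have := neutrixB nkj YE kE; rewrite opprB addrA subrK.
have zE : A i j z.
  by have := neutrixB nij ZE iE; rewrite opprB addrA subrK.
pose ei := z + w / a k q * z - zk * (x / a p q).
pose ek := zi * (w / a p q) - y - x / a i q * y.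
have eiE : A i j ei.
  apply: neutrixB (neutrixD _ zE _) _ => //.
    exact: neutrixM (zeroless_ratio zlk WE) zE.
  exact: neutrixM (alpha_le2 zkE) (rel_imprecision i jq XE).
have ekE : A k j ek.
  apply: neutrixB (neutrixB _ _ yE) _ => //.
    exact: neutrixM (alpha_le2 ziE) (rel_imprecision k jq WE).
  exact: neutrixM (zeroless_ratio zli XE) yE.
(* [ei] and [ek] collect the terms of the minor divided by [a i q] and [a k q]. *)
have cross : zi / a p q + ei / a i q = zk / a p q - ek / a k q.
  apply/eqP; rewrite -subr_eq0; apply/eqP.
  transitivity ((Z * W - X * Y) / (a i q * a k q)); last by rewrite e subrr mul0r.
  rewrite /ei /ek /x /y /z /w; field.
  by rewrite P0 i0 k0.
exists (zi / a p q + ei / a i q).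
  apply/alphaP; have := neutrixD nij iE eiE.
  by congr (A i j _); field; rewrite P0 i0.
rewrite cross; apply/alphaP; have := neutrixB nkj kE ekE.
by congr (A k j _); field; rewrite P0 k0.
Qed.

(** Helly property of cosets of neutrices: they need only meet pairwise, and then
    an element of the one with the least neutrix is common to all. *)
Lemma column_coefficient j : j != q ->
  exists c, forall i, zeroless (alpha i q) -> alpha i j (a i q * c).
Proof.
move=> jq.
pose S i := mink_scale (a i q)^-1 (A i j).
have nS i : neutrix (S i) by exact/neutrix_mink_scale/nA.
pose ord : rel 'I_m := fun i k => `[< S i `<=` S k >].
have ord_refl : reflexive ord by move=> i; apply/asboolP.
have ord_trans : transitive ord.
  by move=> k i l /asboolP ik /asboolP kl; apply/asboolP; exact: subset_trans kl.
have ord_total : total ord.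
  by move=> i k; have [ik|ki] := neutrix_total (nS i) (nS k); apply/orP;
    [left|right]; apply/asboolP.
have zlp : `[< zeroless (alpha p q) >] by apply/asboolP.
have [i0 /asboolP zl0 min0] := extremumP (P := fun i => `[< zeroless (alpha i q) >])
  id ord_refl ord_trans ord_total zlp.
have i00 := zeroless_center zl0.
(* The centre of the least coset serves: its distance to [s] is in [S i0],
   hence in [S k]. *)
exists (a i0 j / a i0 q) => k zlk; have k0 := zeroless_center zlk.
have [s /alphaP s0 /alphaP sk] := rows_compatible jq zl0 zlk.
have /asboolP/(_ ((a i0 q)^-1 * (a i0 q * s - a i0 j))) sub0 :
  ord i0 k by apply/min0/asboolP.
have [|v vE ve] := sub0; first by exists (a i0 q * s - a i0 j).
apply/alphaP; have := neutrixB (nA k j) sk vE; congr (A k j _).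
have -> : v = a k q * ((a k q)^-1 * v) by rewrite mulVKf.
by rewrite ve; field.
Qed.

Lemma rank1_representative :
  exists2 B, representative alpha B & \rank B = 1%N.
Proof.
have P0 := zeroless_center zl_pq.
have /choice[c cE] j : exists c, (j = q -> c = 1) /\
    (j != q -> forall i, zeroless (alpha i q) -> alpha i j (a i q * c)).
  have [->|jq] := eqVneq j q; first by exists 1.
  by have [c cE] := column_coefficient jq; exists c; split=> // jq';
    rewrite jq' eqxx in jq.
pose u := \col_i (if `[< zeroless (alpha i q) >] then a i q else 0).
pose v := \row_j c j.
exists (u *m v) => [i j|].
  rewrite mxE big_ord1 !mxE.
  have [cq cjq] := cE j; case: asboolP => zl.
    have [jq|/cjq/(_ _ zl)//] := eqVneq j q.
    by rewrite cq // mulr1 jq; apply/alphaP; rewrite subrr; exact: neutrix0.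
  rewrite mul0r; have [->|jq] := eqVneq j q; first exact: contrapT zl.
  exact: entry_not_zeroless.
apply/eqP; rewrite eqn_leq mulmx_max_rank /= lt0n mxrank_eq0.
apply/eqP => /matrixP/(_ p q); rewrite !mxE big_ord1 !mxE.
have [-> // _] := cE q; case: asboolP => // _; rewrite mulr1.
exact/eqP.
Qed.

End Pivot.

(** * Maxima and minima of external sets *)

Section Extrema.

(** One statement for the maximum of external numbers and for the maximum
    and the minimum of neutrices.  The predicate [D] is needed because inclusion
    is total on neutrices only. *)
Lemma bigop_upper_bound (T : Type) (op : T -> T -> T) (idx : T)
    (D : T -> Prop) (le : T -> T -> Prop) :
  D idx ->
  (forall x y, D x -> D y -> [/\ D (op x y), le x (op x y) & le y (op x y)]) ->
  (forall y x z, le x y -> le y z -> le x z) ->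
  forall (I : finType) (P : pred I) (F : I -> T), (forall i, P i -> D (F i)) ->
  D (\big[op/idx]_(i | P i) F i) /\
  forall i, P i -> le (F i) (\big[op/idx]_(i | P i) F i).
Proof.
move=> D0 opP le_trans I P F DF.
suff [Db ub] : D (\big[op/idx]_(i | P i) F i) /\
    forall i, i \in index_enum I -> P i ->
    le (F i) (\big[op/idx]_(i | P i) F i).
  by split=> // i; apply: ub; exact: mem_index_enum.
elim: (index_enum I) => [|i r [Dr IH]]; first by rewrite big_nil.
rewrite big_cons; case: ifP => [Pi|nPi]; last first.
  by split=> // k; rewrite inE => /orP[/eqP-> | kr Pk];
    [rewrite nPi | exact: IH].
have [Dop le1 le2] := opP _ _ (DF i Pi) Dr.
split=> // k; rewrite inE => /orP[/eqP-> // | kr Pk].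
exact: le_trans (IH k kr Pk) le2.
Qed.

Variable K : realFieldType.
Implicit Types (X Y N : set K).

Lemma ext_le_refl X : ext_le X X.
Proof. by move=> x Xx; exists x. Qed.

Lemma ext_le_trans Y X Z : ext_le X Y -> ext_le Y Z -> ext_le X Z.
Proof.
move=> XY YZ x /XY[y /YZ[z Zz yz] xy]; exists z => //.
exact: le_trans yz.
Qed.

Lemma ext_le_total X Y : ext_le X Y \/ ext_le Y X.
Proof.
have [|XY] := pselect (ext_le X Y); [by left | right].
move=> y Yy; apply: contrapT => yX; apply: XY => x Xx; exists y => //.
by rewrite leNgt; apply/negP => /ltW yx; apply: yX; exists x.
Qed.

Lemma ext_max_ub X Y : ext_le X (ext_max X Y) /\ ext_le Y (ext_max X Y).
Proof.
rewrite /ext_max; case: asboolP => XY; first by split=> //; exact: ext_le_refl.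
by split; [exact: ext_le_refl | case: (ext_le_total X Y)].
Qed.

Lemma incl_max_ub N M : neutrix N -> neutrix M ->
  [/\ neutrix (incl_max N M), N `<=` incl_max N M & M `<=` incl_max N M].
Proof.
move=> nN nM; rewrite /incl_max; case: asboolP => NM; first by split.
by split=> //; case: (neutrix_total nN nM).
Qed.

Lemma incl_min_lb N M : neutrix N -> neutrix M ->
  [/\ neutrix (incl_min N M), incl_min N M `<=` N & incl_min N M `<=` M].
Proof.
move=> nN nM; rewrite /incl_min; case: asboolP => NM; first by split.
by split=> //; case: (neutrix_total nN nM).
Qed.

Lemma bigincl_max_ub (I : finType) (F : I -> set K) :
  (forall i, neutrix (F i)) ->
  forall i, F i `<=` \big[@incl_max K/[set 0]]_i F i.
Proof.
move=> nF i; have [_] := bigop_upper_bound (le := fun X Y => X `<=` Y)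
  (neutrix_set0 K) incl_max_ub (fun y x z => @subset_trans _ y x z)
  (P := xpredT) (fun i _ => nF i).
exact.
Qed.

Lemma bigincl_min_lb (I : finType) (P : pred I) (F : I -> set K) :
  (forall i, neutrix (F i)) ->
  neutrix (\big[@incl_min K/setT]_(i | P i) F i) /\
  forall i, P i -> \big[@incl_min K/setT]_(i | P i) F i `<=` F i.
Proof.
move=> nF; apply: (bigop_upper_bound (le := fun X Y => Y `<=` X)
  (neutrix_setT K) incl_min_lb _ (fun i _ => nF i)).
by move=> y x z yx zy; exact: subset_trans yx.
Qed.

Lemma bigext_max_ub (I : finType) (F : I -> set K) i :
  ext_le (F i) (\big[@ext_max K/[set 0]]_i F i).
Proof.
apply: (bigop_upper_bound (D := fun=> True) (le := @ext_le K) (P := xpredT)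
  _ _ ext_le_trans _).2 => // X Y _ _.
by have [] := ext_max_ub X Y.
Qed.

Lemma bigext_max_attained m n (F : 'I_m -> 'I_n -> set K) :
  let M := \big[@ext_max K/[set 0]]_(i < m)
    \big[@ext_max K/[set 0]]_(j < n) F i j in
  M = [set 0] \/ exists i j, M = F i j.
Proof.
move=> M; rewrite {}/M.
have sel (S : set K -> Prop) X Y : S X -> S Y -> S (ext_max X Y).
  by move=> SX SY; rewrite /ext_max; case: asboolP.
apply: (big_ind (fun X => X = [set 0] \/ exists i j, X = F i j)).
- by left.
- exact: sel.
move=> i _; apply: (big_ind (fun X => X = [set 0] \/ exists i j, X = F i j)).
- by left.
- exact: sel.
by move=> j _; right; exists i, j.
Qed.

(** Only an [X := extnum a N] that meets both sides of 0 needs an argument: if it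
    contains [x < 0 <= y], then
    [y + (y - x)] is in [X] too, because [y - x] is in [N]; so it bounds [- x]. *)
Lemma extnum_ext_abs_le2 a N N1 : neutrix N -> N1 `<=` @infinitesimals K ->
  ext_le (ext_abs (extnum a N)) (extnum 1 N1) ->
  forall x, extnum a N x -> `|x| <= 2.
Proof.
move=> nN N1inf; set X := extnum a N => le1.
have le2 x : ext_abs X x -> x <= 2.
  move=> /le1[_ [y /N1inf/(_ 0) y1 <-] /le_trans]; apply.
  rewrite -[2]/(1 + 1) lerD2l; rewrite invr1 in y1.
  exact: le_trans (ler_norm _) (ltW y1).
move: le2; rewrite /ext_abs; case: asboolP => [X0|nX0] le2 x Xx; last first.
  have x0 : x < 0.
    rewrite ltNge; apply/negP => x0; apply: nX0 => _ ->; by exists x.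
  by rewrite ltr0_norm //; apply: le2; exists x.
have [y Xy y0] := X0 _ erefl.
have [x0|x0] := ger0P x; first by move=> *; exact: le2.
have X2 : X (y + (y - x)).
  move: Xx Xy => /extnumE Nx /extnumE Ny; apply/extnumE.
  have := neutrixD nN Ny (neutrixB nN Ny Nx); congr (N _); ring.
have := le2 _ X2; lra.
Qed.

End Extrema.

(** * Reduced matrices *)

Section Reduced.
Variables (K : realFieldType) (m n : nat).
Variables (alpha : 'M[set K]_(m, n)) (a : 'M[K]_(m, n)) (A : 'M[set K]_(m, n)).
Hypothesis nA : forall i j, neutrix (A i j).
Hypothesis alphaE : forall i j, alpha i j = extnum (a i j) (A i j).
Hypothesis red : reduced alpha.

Lemma reduced_le2 i j x : alpha i j x -> `|x| <= 2.
Proof.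
have [N [nN Ninf maxE]] := red; rewrite alphaE.
apply: (extnum_ext_abs_le2 (nA i j) Ninf); rewrite -maxE -alphaE.
have lej := @bigext_max_ub _ _ (fun j => ext_abs (alpha i j)) j.
apply: (ext_le_trans lej).
exact: (@bigext_max_ub _ _
  (fun i => \big[@ext_max K/[set 0]]_j ext_abs (alpha i j)) i).
Qed.

(** An entry of maximal absolute value 1 + N is a pivot by which one can divide
    without changing any neutrix. *)
Lemma reduced_unit_entry : exists i j, forall x, alpha i j x -> 2^-1 <= `|x|.
Proof.
have [N [nN Ninf maxE]] := red.
have half z : extnum 1 N z -> 2^-1 <= `|z|.
  move=> [y /Ninf/(_ 1%N) y2 <-]; move: y2; rewrite ltr_norml => /andP[y2 _].
  apply: le_trans (ler_norm _); move: y2; lra.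
have := bigext_max_attained (fun i j => ext_abs (alpha i j)).
rewrite /= maxE => -[N0|[i [j ijE]]].
  have : extnum 1 N 1 by apply/extnumE; rewrite subrr; exact: neutrix0.
  by rewrite N0 /= => /eqP; rewrite oner_eq0.
exists i, j => x xE; move: ijE; rewrite /ext_abs; case: asboolP => _ E.
  by apply: half; rewrite E.
by rewrite -normrN; apply: half; rewrite E; exists x.
Qed.

Lemma rank1_of_pivot p q : minor_rank alpha = 1%N -> zeroless (alpha p q) ->
  (forall i k j x, j != q -> A i q x -> A k j (x / a p q)) ->
  exists2 B, representative alpha B & \rank B = 1%N.
Proof.
move=> mr1 zl rel; apply: (rank1_representative nA alphaE reduced_le2 _ zl rel).
move=> i k j l; apply: singular_minors mr1 _ => {}i {}j; exists (a i j).
by rewrite alphaE; apply/extnumE; rewrite subrr; exact: neutrix0.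
Qed.

End Reduced.

Theorem theorem7p14 (R : realType) (K : realFieldType)
    (star : forall k, set ('I_k -> R) -> set ('I_k -> K))
    (hK : nonstandard_extension star)
    (m n : nat) (alpha : 'M[set K]_(m.+1, n.+1))
    (a : 'M[K]_(m.+1, n.+1)) (A : 'M[set K]_(m.+1, n.+1))
    (hA : forall i j, neutrix (A i j))
    (halpha : forall i j, alpha i j = extnum (a i j) (A i j))
    (hred : reduced alpha)
    (hmr : minor_rank alpha = 1%N)
    (h11 : zeroless (alpha ord0 ord0))
    (hyp :
      (let A1_max := \big[@incl_max K/[set 0]]_(i < m.+1) A i ord0 in
       let A1C_min := \big[@incl_min K/setT]_(i < m.+1)
         \big[@incl_min K/setT]_(j < n.+1 | j != ord0) A i j in
       [set x / a ord0 ord0 | x in A1_max] `<=` A1C_min)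
      \/
      (exists N : set K, neutrix N /\ forall i j, A i j = N)) :
  row_rank alpha = 1%N /\ strict_rank alpha = Some 1%N.
Proof.
have [B rB rkB] : exists2 B, representative alpha B & \rank B = 1%N.
  case: hyp => /= [hi|[N [nN AN]]].
    apply: (rank1_of_pivot hA halpha hred hmr h11) => i k j x j0 Ax.
    have [nF minF] := bigincl_min_lb xpredT (fun i => (bigincl_min_lb
      (fun j => j != ord0) (fun j => hA i j)).1).
    have [_ minFk] := bigincl_min_lb (fun j => j != ord0) (fun j => hA k j).
    apply/(minFk j j0)/(minF k isT)/hi; exists x => //.
    exact: (bigincl_max_ub (fun i => hA i ord0)) Ax.
  (* Equal neutrices: the pivot is an entry that attains the maximum. *)
  have [p [q half]] := reduced_unit_entry hred.
  have zl : zeroless (alpha p q).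
    by move=> /half; rewrite normr0 leNgt invr_gt0 ltr0n.
  apply: (rank1_of_pivot hA halpha hred hmr zl) => i k j x _.
  rewrite !AN mulrC; apply: neutrixM => //.
  rewrite normfV invf_ple ?posrE ?normr_gt0 ?(zeroless_center hA halpha) //.
  by apply: half; rewrite halpha; apply/extnumE; rewrite subrr; exact: neutrix0.
split.
  apply/eqP; rewrite eqn_leq (row_rank_gt0 h11) andbT.
  by have := row_rank_le_rank hA halpha rB; rewrite rkB.
by rewrite /strict_rank hmr; case: asboolP => // -[]; exists B.
Qed.
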